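(* Let $k$ be an algebraically closed field and let $d,n\ge 2$ be integers. The rational map $$\phi:\mathbb{P}^n_k\dashrightarrow\mathbb{P}^n_k,\qquad (x_0:\dots:x_n)\mapsto (x_0^d : x_0^{d-1}x_1 : x_1^{d-1}x_2:\dots : x_{n-1}^{d-1}x_n),$$ i.e. the map with coordinates $g_0=x_0^d$ and $g_i=x_{i-1}^{d-1}x_i$ for $1\le i\le n$, is a monomial Cremona transformation of degree $d$, and its inverse has degree $$d'=1+(d-1)+(d-1)^2+\dots+(d-1)^{n-1},$$ which equals $\frac{(d-1)^n-1}{d-2}$ if $d>2$.
   Context: A Cremona transformation is a birational map $\mathbb{P}^n_k\dashrightarrow\mathbb{P}^n_k$; it is monomial if it can be given by monomials of the same degree. Its degree is the common degree of the homogeneous polynomials defining it once all common nonconstant factors have been canceled. *)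

(* Defs.v *)
From HB Require Import structures.
From mathcomp Require Import all_boot all_order all_algebra.
From mathcomp Require Import mpoly.

Set Implicit Arguments.
Unset Strict Implicit.
Unset Printing Implicit Defensive.

Import GRing.Theory.
Local Open Scope ring_scope.

(* A rational map P^n --> P^n over k is presented by n+1 forms of the same    *)
(* degree in n+1 variables, not all zero; two presentations define the same   *)
(* map iff they are proportional over k(x_0, ..., x_n) (see same_map).        *)
Notation coords k n := (n.+1.-tuple {mpoly k[n.+1]}).

Section RationalMaps.

Variables (k : fieldType) (n : nat).
Implicit Types f g h : coords k n.

Definition forms_of_degree (e : nat) f : Prop :=
  forall i, tnth f i \is e.-homog.

Definition not_all_zero f : Prop := exists i, tnth f i != 0.

Definition is_rational_map f : Prop :=
  (exists e, forms_of_degree e f) /\ not_all_zero f.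

(* Vanishing of the 2 x 2 minors of (f; g). It is an equivalence relation     *)
(* only among tuples that are not identically zero.                           *)
Definition same_map f g : Prop :=
  forall i j, tnth f i * tnth g j = tnth f j * tnth g i.

Definition id_map : coords k n := [tuple 'X_i | i < n.+1].

(* f o g; it is defined as a rational map only if the result is not all zero, *)
(* i.e. if the image of g is not contained in the common zeros of f.          *)
Definition comp_map f g : coords k n := [tuple tnth f i \mPo g | i < n.+1].

Definition is_inverse f g : Prop :=
  [/\ is_rational_map g,
      not_all_zero (comp_map f g) /\ same_map (comp_map f g) id_map
    & not_all_zero (comp_map g f) /\ same_map (comp_map g f) id_map].

Definition is_cremona f : Prop :=
  is_rational_map f /\ exists g, is_inverse f g.

Definition is_monomial f : Prop :=
  exists (e : nat) (m : 'I_n.+1 -> 'X_{1..n.+1}),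
    (forall i, mdeg (m i) = e) /\ same_map f [tuple 'X_[m i] | i < n.+1].

Definition no_common_factor h : Prop :=
  forall c : {mpoly k[n.+1]},
    (forall i, exists q, tnth h i = c * q) -> exists a : k, c = a%:MP.

(* For a rational map f such an h is unique up to a scalar, because the       *)
(* polynomial ring is factorial; hence e is determined by f.                  *)
Definition has_degree f (e : nat) : Prop :=
  exists h, [/\ forms_of_degree e h, not_all_zero h, same_map f h
              & no_common_factor h].

End RationalMaps.

Definition phi (k : fieldType) (d n : nat) : coords k n :=
  [tuple if i == ord0 then 'X_ord0 ^+ d
         else 'X_(inord i.-1) ^+ d.-1 * 'X_i | i < n.+1].

(* Main.v *)
Require Import Defs.
From HB Require Import structures.
From mathcomp Require Import all_boot all_order all_algebra.
From mathcomp Require Import mpoly zify ring.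

Set Implicit Arguments.
Unset Strict Implicit.
Unset Printing Implicit Defensive.

Import Order.TTheory GRing.Theory Num.Theory.
Local Open Scope ring_scope.

(** Put e = d - 1 and t_i = x_i / x_0, s_i = y_i / y_0.  The equations
    y = phi(x) read s_i = t_(i-1)^e t_i, so t_i is the product of the
    s_j^((-e)^(i-j)) over 1 <= j <= i: the inverse is monomial, and row i of
    its exponent matrix is [inv_dev e i] up to adding the same vector to all
    rows.  The vector [inv_shift e n] clears the denominators and leaves no
    common factor; its sum is the degree of the inverse.  Any other inverse
    is proportional to this one. *)

(** * Signed exponents of the inverse and the shift that makes them nonnegative *)

Definition alt_sum (e s : nat) : int := \sum_(l < s) (- e%:Z) ^+ l.

Definition odd_floor (t : nat) : nat := if odd t then t else t.-1.

(* The maximum of - (- e) ^ s over s <= t when e > 0, replaced by 0 if negative. *)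
Definition odd_peak (e t : nat) : nat := if t == 0%N then 0%N else (e ^ odd_floor t)%N.

(** Exponents of t_i as a Laurent monomial in y. Column 0 collects the denominators y_0 of s_1, ...,
    s_i. *)
Definition inv_dev (e i j : nat) : int :=
  if j == 0%N then - alt_sum e i
  else if (j <= i)%N then (- e%:Z) ^+ (i - j) else 0.

(** For e > 0 and j <= n this is the maximum of [- inv_dev e i j] over the rows i <= n, hence the
    least shift that makes column j nonnegative. *)
Definition inv_shift (e n j : nat) : int :=
  if j == 0%N then alt_sum e (odd_floor n) else (odd_peak e (n - j))%:Z.

(** For e > 0 and i <= n, [absz] changes no value: the shifted exponent is nonnegative by
    [inv_expE]. *)
Definition inv_exp (e n i j : nat) : nat := absz (inv_shift e n j + inv_dev e i j).

Lemma alt_sumS e s : alt_sum e s.+1 = alt_sum e s + (- e%:Z) ^+ s.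
Proof. by rewrite /alt_sum big_ord_recr. Qed.

Lemma alt_sum_mul e s : (e%:Z + 1) * alt_sum e s = 1 - (- e%:Z) ^+ s.
Proof.
elim: s => [|s IHs]; first by rewrite /alt_sum big_ord0 expr0 mulr0 subrr.
by rewrite alt_sumS mulrDr IHs exprS; ring.
Qed.

Lemma alt_sum_recl e s : alt_sum e s.+1 = 1 - e%:Z * alt_sum e s.
Proof. by move: (alt_sum_mul e s); rewrite alt_sumS; move: (_ ^+ s) (alt_sum e s) => x y; lia. Qed.

Lemma signed_power e s : (- e%:Z) ^+ s = (-1) ^+ odd s * (e ^ s)%N%:Z.
Proof. by rewrite signr_odd [LHS]exprNn -[(e ^ s)%N%:Z]natz natrX natz. Qed.

Lemma odd_floor_le t : (odd_floor t <= t)%N.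
Proof. by rewrite /odd_floor; case: ifP; lia. Qed.

Lemma odd_odd_floor t : (0 < t)%N -> odd (odd_floor t).
Proof. by rewrite /odd_floor; case: ifP; lia. Qed.

(** The partial sums peak at odd indices: from an odd index t, the next term subtracts e^t, and the
    next two together add e^(t+1) - e^t >= 0. *)
Lemma alt_sum_le_odd_floor e s t :
  (0 < e)%N -> (s <= t)%N -> alt_sum e s <= alt_sum e (odd_floor t).
Proof.
move=> e_gt0; elim: t => [|t IHt]; first by rewrite leqn0 => /eqP->.
rewrite leq_eqVlt => /predU1P[->|/IHt le_s].
  rewrite /odd_floor; case: ifP => //= /negbFE odd_t.
  by rewrite alt_sumS signed_power odd_t expr1 mulN1r lerBlDr lerDl.
apply: le_trans le_s _; rewrite /odd_floor /=; have [//|even_t] := boolP (odd t).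
case: t even_t {IHt} => [|t] /=; first by rewrite alt_sumS lerDl expr0.
rewrite negbK => odd_t; rewrite !alt_sumS -addrA lerDl.
rewrite (signed_power e t.+1) (signed_power e t) /= odd_t expr1 expr0.
by rewrite mulN1r mul1r addrC subr_ge0 lez_nat leq_pexp2l.
Qed.

Lemma signed_power_ge e s t :
  (0 < e)%N -> (s <= t)%N -> - (odd_peak e t)%:Z <= (- e%:Z) ^+ s.
Proof.
move=> e_gt0 le_st; rewrite signed_power.
case odd_s: (odd s); last by rewrite expr0 mul1r; lia.
rewrite expr1 mulN1r lerN2 lez_nat /odd_peak ifF; last by lia.
by rewrite leq_pexp2l // /odd_floor; case: ifP; lia.
Qed.

Lemma inv_expE e n i j : (0 < e)%N -> (i <= n)%N ->
  (inv_exp e n i j)%:Z = inv_shift e n j + inv_dev e i j.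
Proof.
move=> e_gt0 le_in; rewrite /inv_exp gez0_abs // /inv_shift /inv_dev.
case: ifP => [_|_]; first by rewrite subr_ge0 alt_sum_le_odd_floor.
case: ifP => [le_ji|_]; last by rewrite addr0.
by rewrite -lerBlDl sub0r signed_power_ge // leq_sub2r.
Qed.

Lemma inv_dev0 e j : inv_dev e 0 j = 0.
Proof. by rewrite /inv_dev /alt_sum; case: j => [|j] //=; rewrite big_ord0. Qed.

(** This is s_(i+1) = t_i^e t_(i+1) read on exponents of y, with s_(i+1) = y_(i+1) / y_0. *)
Lemma inv_dev_recl e i j :
  inv_dev e i.+1 j + e%:Z * inv_dev e i j = (i.+1 == j)%:Z - (j == 0)%N%:Z.
Proof.
rewrite /inv_dev; case: j => [|j] /=; first by rewrite alt_sum_recl; ring.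
rewrite !ltnS eqSS subSS; have [lt_ji|lt_ij|->] := ltngtP j i => /=.
- by rewrite -(subnSK lt_ji) exprS /=; ring.
- by ring.
- by rewrite subnn; ring.
Qed.

(** Exponent of x_(j+1) in t_i after substituting y = phi(x): this variable occurs once in y_(j+1)
    and e times in y_(j+2). *)
Lemma inv_dev_recr e i j :
  inv_dev e i j.+1 + e%:Z * inv_dev e i j.+2 = (i == j.+1)%:Z.
Proof.
rewrite /inv_dev /=; have [lt_ij|lt_ji|->] := ltngtP i j.+1 => /=.
- by ring.
- by rewrite -(subnSK lt_ji) exprS; ring.
- by rewrite subnn; ring.
Qed.

(** The same for x_0, which occurs e + 1 times in y_0 and e times in y_1; the -1 is the denominator
    of t_i = x_i / x_0. *)
Lemma inv_dev_recr0 e i :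
  (e%:Z + 1) * inv_dev e i 0 + e%:Z * inv_dev e i 1 = (i == 0%N)%:Z - 1.
Proof.
rewrite /inv_dev /= mulrN alt_sum_mul; case: i => [|i] /=; first by rewrite expr0; ring.
by rewrite subn1 exprS /=; ring.
Qed.

Lemma inv_exp_eq0 e n j : (0 < e)%N -> (0 < n)%N -> (j <= n)%N ->
  exists2 i, (i <= n)%N & inv_exp e n i j = 0%N.
Proof.
move=> e_gt0 n_gt0 le_jn; case: j le_jn => [_|j lt_jn].
  (* The row where the maximum defining the shift is attained. *)
  exists (odd_floor n); first exact: odd_floor_le.
  by rewrite /inv_exp /inv_shift /inv_dev /= subrr.
rewrite /inv_exp /inv_shift /inv_dev /= /odd_peak subn_eq0.
(* In the last column the shift is 0, and row 0 has exponent 0 there. *)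
have [le_nj|lt_jn'] := leqP n j.+1; first by exists 0%N => //.
exists (j.+1 + odd_floor (n - j.+1))%N.
  by have := odd_floor_le (n - j.+1); lia.
rewrite leq_addr addKn signed_power odd_odd_floor ?subn_gt0 //.
by rewrite expr1 mulN1r subrr.
Qed.

(** Each t_i has degree 0 in y: by [inv_dev_recl] each row sum is -e times the previous one, and row
    0 vanishes. *)
Lemma sum_inv_dev e n i : (i <= n)%N -> \sum_(j < n.+1) inv_dev e i j = 0.
Proof.
elim: i => [_|i IHi lt_in]; first by rewrite big1 // => j _; rewrite inv_dev0.
have: \sum_(j < n.+1) (inv_dev e i.+1 j + e%:Z * inv_dev e i j) = 0.
  under eq_bigr => j _ do rewrite inv_dev_recl.
  have sum_eq1 (l : 'I_n.+1) : \sum_(j < n.+1) (l == j)%:Z = 1 :> int.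
    by rewrite (bigD1 l) //= eqxx big1 // => j /negbTE; rewrite eq_sym => ->.
  rewrite sumrB (sum_eq1 (Ordinal (lt_in : i.+1 < n.+1)%N)).
  rewrite (eq_bigr (fun j : 'I_n.+1 => (ord0 == j)%:Z)) ?sum_eq1 ?subrr // => j _.
  by rewrite eq_sym.
by rewrite big_split /= -mulr_sumr IHi ?mulr0 ?addr0 // ltnW.
Qed.

(** Passing from n to n + 1 adds e^n. For odd n it all comes from the new peak; for even n > 0 the
    peak gives e^(n-1) and the alternating sum e^n - e^(n-1). *)
Lemma sum_odd_peak e n :
  alt_sum e (odd_floor n) + (\sum_(0 <= t < n) odd_peak e t)%N%:Z =
    (\sum_(0 <= i < n) e ^ i)%N%:Z.
Proof.
elim: n => [|n IHn]; first by rewrite !big_geq // /alt_sum big_ord0.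
rewrite !big_nat_recr //= !PoszD -IHn addrCA.
suff -> : alt_sum e (odd_floor n.+1) + (odd_peak e n)%:Z =
          alt_sum e (odd_floor n) + (e ^ n)%N%:Z by ring.
rewrite /odd_peak {IHn}; case: n => [|n] /=.
  by rewrite /odd_floor /= alt_sumS expr0 addr0.
rewrite /odd_floor /= negbK; case: ifP => odd_n //=.
rewrite !alt_sumS (signed_power e n.+1) (signed_power e n) /= odd_n.
by rewrite expr0 expr1; ring.
Qed.

Lemma sum_inv_shift e n :
  \sum_(j < n.+1) inv_shift e n j = (\sum_(0 <= i < n) e ^ i)%N%:Z.
Proof.
rewrite big_ord_recl -sum_odd_peak; congr (_ + _).
rewrite big_mkord (big_morph Posz PoszD (erefl 0)) (reindex_inj rev_ord_inj) /=.
by apply: eq_bigr => j _; rewrite /inv_shift /= /bump add1n subnSK ?subKn // ltnW.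
Qed.

Lemma sum_inv_exp e n i : (0 < e)%N -> (i <= n)%N ->
  (\sum_(j < n.+1) inv_exp e n i j = \sum_(0 <= i < n) e ^ i)%N.
Proof.
move=> e_gt0 le_in; apply/eqP; rewrite -eqz_nat -sum_inv_shift (big_morph Posz PoszD (erefl 0)).
under eq_bigr => j _ do rewrite inv_expE //.
by rewrite big_split /= sum_inv_dev // addr0.
Qed.

(** * Monomial maps: composition, degree, uniqueness of the inverse *)

Section MonomialMaps.

Variables (k : fieldType) (n : nat).
Implicit Types (m p q : 'I_n.+1 -> 'X_{1..n.+1}) (f g h psi : coords k n).

Definition monomial_map m : coords k n := [tuple 'X_[m i] | i < n.+1].

Lemma mpolyX_prod_ord (I : finType) (F : I -> 'X_{1..n.+1}) (e : I -> nat) :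
  \prod_i ('X_[F i] ^+ e i : {mpoly k[n.+1]}) = 'X_[(\sum_i (F i *+ e i))%MM].
Proof.
under eq_bigr => i _ do rewrite mpolyXn.
by rewrite -(big_map (fun i => (F i *+ e i)%MM) xpredT (fun x => 'X_[x])) mpolyX_prod big_map.
Qed.

Lemma comp_monomial_map p q :
  comp_map (monomial_map p) (monomial_map q) =
    monomial_map (fun i => \sum_j q j *+ p i j)%MM.
Proof.
apply: eq_from_tnth => i; rewrite !tnth_mktuple comp_mpolyX -mpolyX_prod_ord.
by apply: eq_bigr => j _; rewrite tnth_mktuple.
Qed.

Lemma not_all_zero_monomial_map m : not_all_zero (monomial_map m).
Proof. by exists ord0; rewrite tnth_mktuple -msize_poly_eq0 msizeX. Qed.

Lemma forms_of_degree_monomial_map m e :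
  (forall i, mdeg (m i) = e) -> forms_of_degree e (monomial_map m).
Proof. by move=> deg_m i; rewrite tnth_mktuple dhomogX /= deg_m. Qed.

Lemma is_monomial_monomial_map m e :
  (forall i, mdeg (m i) = e) -> is_monomial (monomial_map m).
Proof. by move=> deg_m; exists e, m; split=> // i j; rewrite mulrC. Qed.

(* The leading exponent of a common factor is below every [m i], hence 0, and *)
(* the monomial order is graded.                                              *)
Lemma no_common_factor_monomial_map m :
  (forall j, exists i, m i j = 0%N) -> no_common_factor (monomial_map m).
Proof.
move=> m_eq0 c c_dvd; exists c@_0; apply: msize1_polyC.
have cF i : exists2 q, c != 0 /\ q != 0 & 'X_[m i] = c * q.
  have [q] := c_dvd i; rewrite tnth_mktuple => Xcq.
  exists q => //; apply/andP; rewrite -negb_or -mulf_eq0 -Xcq.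
  by rewrite -msize_poly_eq0 msizeX.
have c_neq0 : c != 0 by case: (cF ord0) => q [].
rewrite -mlead_deg // ltnS leqn0 mdeg_eq0; apply/eqP/mnmP => j.
have [i m_ij] := m_eq0 j; have [q [_ q_neq0] Xcq] := cF i.
have := mleadM c_neq0 q_neq0; rewrite -Xcq mleadXm => /(congr1 (fun u : 'X_{1..n.+1} => u j)).
by rewrite mnmDE m_ij mnm0E => /esym/eqP; rewrite addn_eq0 => /andP[/eqP].
Qed.

Lemma has_degree_monomial_map f m e :
    (forall i, mdeg (m i) = e) -> (forall j, exists i, m i j = 0%N) ->
  same_map f (monomial_map m) -> has_degree f e.
Proof.
move=> deg_m m_eq0 fm; exists (monomial_map m); split=> //.
- exact: forms_of_degree_monomial_map.
- exact: not_all_zero_monomial_map.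
- exact: no_common_factor_monomial_map.
Qed.

(** Every monomial of [u] has degree e, so each picks up the same factor c^e. *)
Lemma dhomog_comp_scale e c g (u : {mpoly k[n.+1]}) :
  u \is e.-homog -> (forall i, tnth g i = c * 'X_i) -> u \mPo g = c ^+ e * u.
Proof.
move=> u_homog gE; rewrite comp_mpolyE {3}[u]mpolyE mulr_sumr.
apply: eq_big_seq => m /(dhomog_mf u_homog) /= deg_m.
rewrite -scalerAr; congr (_ *: _).
under eq_bigr => i _ do rewrite gE exprMn.
by rewrite big_split /= prodrXr -mdegE deg_m -mpolyXE_id.
Qed.

Lemma comp_mpolyA (u : {mpoly k[n.+1]}) f g :
  (u \mPo f) \mPo g = u \mPo comp_map f g.
Proof.
rewrite (comp_mpolyE u f) (comp_mpolyE u (comp_map f g)) raddf_sum.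
apply: eq_bigr => m _; rewrite /= comp_mpolyZ rmorph_prod; congr (_ *: _).
by apply: eq_bigr => i _; rewrite rmorphXn tnth_mktuple.
Qed.

Lemma same_map_scale c f g :
  (forall i, tnth f i = c * tnth g i) -> same_map f g.
Proof. by move=> fE i j; rewrite !fE mulrAC. Qed.

(* Substituting g into psi o f ~ id gives psi ~ g: f o g is the identity up   *)
(* to a common factor, which the homogeneity of psi takes out.                *)
Lemma left_inverse_unique f g psi c e :
    forms_of_degree e psi -> c != 0 ->
    (forall i, tnth (comp_map f g) i = c * 'X_i) ->
    same_map (comp_map psi f) (id_map k n) ->
  same_map psi g.
Proof.
move=> psi_homog c_neq0 fgE psif i j.
have psi_fg l : (tnth psi l \mPo f) \mPo g = c ^+ e * tnth psi l.
  by rewrite -(dhomog_comp_scale (psi_homog l) fgE) comp_mpolyA.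
have := congr1 (fun u => u \mPo g) (psif i j).
rewrite !tnth_mktuple !rmorphM /= !comp_mpolyXU -!tnth_nth !psi_fg -!mulrA.
by apply: mulfI; rewrite expf_neq0.
Qed.

End MonomialMaps.

(** * The exponent matrices of phi and of its inverse *)

Section InverseOfPhi.

Variables (e n : nat).
Hypotheses (e_gt0 : (0 < e)%N) (n_gt0 : (0 < n)%N).

Definition phi_mnm (i : 'I_n.+1) : 'X_{1..n.+1} :=
  if i == ord0 then (U_(ord0) *+ e.+1)%MM
  else (U_(inord i.-1) *+ e + U_(i))%MM.

Definition inv_mnm (i : 'I_n.+1) : 'X_{1..n.+1} :=
  [multinom inv_exp e n i j | j < n.+1].

Lemma phi_monomial_map (k : fieldType) : phi k e.+1 n = monomial_map k phi_mnm.
Proof.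
apply: eq_from_tnth => i; rewrite !tnth_mktuple /phi_mnm.
by case: ifP => _; rewrite ?mpolyXD -mpolyXn.
Qed.

Lemma phi_mnmE (i j : 'I_n.+1) :
  phi_mnm i j = if i == 0%N :> nat then ((j == 0%N :> nat) * e.+1)%N
                else ((i == j.+1 :> nat) * e + (i == j :> nat))%N.
Proof.
rewrite /phi_mnm -val_eqE /=; case: ifP => i_eq0.
  by rewrite mulmnE mnm1E -val_eqE /= eq_sym.
rewrite mnmDE mulmnE !mnm1E -!val_eqE /= inordK; last by have := ltn_ord i; lia.
by congr (_ * _ + _)%N; lia.
Qed.

Lemma mdeg_phi_mnm i : mdeg (phi_mnm i) = e.+1.
Proof.
rewrite /phi_mnm; case: ifP => _; first by rewrite mdegMn mdeg1 mul1n.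
by rewrite mdegD mdegMn !mdeg1 mul1n addn1.
Qed.

Lemma phi_mnm_eq0 j : (1 < n)%N -> exists i, phi_mnm i j = 0%N.
Proof.
move=> n_gt1; case: (posnP j) => [j_eq0|j_gt0].
  (* The coordinate x_1^e x_2 is the first one free of x_0, whence n >= 2. *)
  by exists (Ordinal (n_gt1 : 2 < n.+1)%N); rewrite phi_mnmE /= j_eq0.
by exists ord0; rewrite phi_mnmE /= gtn_eqF.
Qed.

Lemma mdeg_inv_mnm i : mdeg (inv_mnm i) = (\sum_(0 <= j < n) e ^ j)%N.
Proof.
rewrite mdegE -(sum_inv_exp e_gt0 (leq_ord i)).
by apply: eq_bigr => j _; rewrite mnmE.
Qed.

Lemma inv_mnm_eq0 j : exists i, inv_mnm i j = 0%N.
Proof.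
have [i le_in i_eq0] := inv_exp_eq0 e_gt0 n_gt0 (leq_ord j).
by exists (Ordinal (le_in : i < n.+1)%N); rewrite mnmE.
Qed.

Lemma sum_phi_mnm_row (F : nat -> nat) (i : 'I_n.+1) :
  (\sum_(j < n.+1) F j * phi_mnm i j =
     if i == 0%N :> nat then e.+1 * F 0 else e * F i.-1 + F i)%N.
Proof.
have sum1 m : (m < n.+1)%N -> (\sum_(j < n.+1) F j * (j == m :> nat) = F m)%N.
  move=> lt_mn; rewrite (bigD1 (Ordinal lt_mn)) //= eqxx muln1 big1 ?addn0 // => j.
  by rewrite -val_eqE /= => /negbTE ->; rewrite muln0.
under eq_bigr => j _ do rewrite phi_mnmE.
case: ifP => i_eq0; [rewrite -(sum1 0%N) // | rewrite -[F i](sum1 i) //].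
  by rewrite big_distrr; apply: eq_bigr => j _; rewrite mulnA [LHS]mulnC.
rewrite -(sum1 i.-1) ?big_distrr -?big_split; last by have := ltn_ord i; lia.
by apply: eq_bigr => j _ /=; rewrite (_ : (j == i.-1 :> nat) = (i == j.+1 :> nat)) 1?[i == j]eq_sym; lia.
Qed.

(** The condition on [G n.+1] lets the last column follow the general formula, although x_n occurs
    in y_n only. *)
Lemma sum_phi_mnm_col (G : nat -> nat) (j : 'I_n.+1) : G n.+1 = 0%N ->
  (\sum_(i < n.+1) phi_mnm i j * G i =
     (if j == 0%N :> nat then e.+1 * G 0 else G j) + e * G j.+1)%N.
Proof.
move=> G_eq0.
have sum1 m : (0 < m <= n.+1)%N -> (\sum_(i < n) (i.+1 == m :> nat) * G i.+1 = G m)%N.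
  case: m => // m; rewrite /= ltnS leq_eqVlt => /predU1P[->|lt_mn].
    by rewrite G_eq0 big1 // => i _; rewrite eqSS ltn_eqF // ltn_ord.
  rewrite (bigD1 (Ordinal lt_mn)) //= eqxx mul1n big1 ?addn0 // => i.
  by rewrite -val_eqE eqSS /= => /negbTE ->.
under eq_bigr => i _ do rewrite phi_mnmE.
rewrite big_ord_recl /=; under eq_bigr => i _ do rewrite /bump add1n /=.
rewrite -[G j.+1](sum1 j.+1) ?ltnS ?leq_ord // big_distrr /=.
have [j_eq0|j_gt0] := posnP j.
  rewrite j_eq0 mul1n; congr (_ + _)%N; apply: eq_bigr => i _.
  by rewrite addn0 mulnAC [LHS]mulnC.
rewrite -[G j](sum1 j) ?j_gt0 ?(leqW (leq_ord j)) // mul0n add0n -big_split.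
by apply: eq_bigr => i _; rewrite /= mulnDl addnC mulnAC [(_ * e)%N]mulnC.
Qed.

(* In column j, the common factor is read off from any row i <> j; hence its *)
(* exponents are nonnegative.                                                *)
Lemma common_factor_mnm (N : 'I_n.+1 -> 'X_{1..n.+1}) (c : nat -> int) :
    (forall i j, (N i j)%:Z = c j + (i == j)%N%:Z) ->
  exists C : 'X_{1..n.+1}, forall i, N i = (C + U_(i))%MM.
Proof.
move=> NE; exists [multinom N (inord (j == ord0)) j | j < n.+1] => i.
apply/mnmP => j; rewrite mnmDE mnmE mnm1E; apply/eqP.
rewrite -eqz_nat PoszD !NE (_ : inord _ == j = false) ?addr0 //.
rewrite -!val_eqE /= inordK; last by case: eqP.
by case: j => [[|j] ?].
Qed.

Lemma phi_inv_mnm :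
  exists C, forall i, (\sum_j inv_mnm j *+ phi_mnm i j = C + U_(i))%MM.
Proof.
(* The factor is forced by row 0: there [inv_dev] vanishes, so the product is d times the shift, and
   one x_0 is split off. *)
apply: (@common_factor_mnm _ (fun j => e.+1%:Z * inv_shift e n j - (j == 0%N)%:Z)) => i j.
rewrite mnm_sumE; under eq_bigr => l _ do rewrite mulmnE mnmE.
rewrite (sum_phi_mnm_row (fun l => inv_exp e n l j)) -val_eqE /=.
case: i => [[|i] lt_in] /=.
  by rewrite PoszM inv_expE // inv_dev0 addr0 eq_sym; ring.
rewrite PoszD PoszM !inv_expE //; last by lia.
have -> : (i.+1 == j)%:Z = inv_dev e i.+1 j + e%:Z * inv_dev e i j + (j == 0%N :> nat)%:Z.
  by rewrite inv_dev_recl subrK.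
by rewrite -[e.+1]addn1 PoszD; ring.
Qed.

Lemma inv_phi_mnm :
  exists C, forall i, (\sum_j phi_mnm j *+ inv_mnm i j = C + U_(i))%MM.
Proof.
(* Exponent of x_j contributed by the shift after substituting phi, lowered by 1 at x_0 for the
   denominator of t_i. *)
apply: (@common_factor_mnm _ (fun j =>
  (if j == 0%N then e.+1%:Z * inv_shift e n 0 - 1 else inv_shift e n j)
  + e%:Z * inv_shift e n j.+1)) => i j.
rewrite mnm_sumE; under eq_bigr => l _ do rewrite mulmnE mnmE.
rewrite (sum_phi_mnm_col j (G := inv_exp e n i)); last first.
  (* Column n + 1 is zero: the truncated [n - n.+1] is 0, where [odd_peak] is 0, and i < n + 1. *)
  by rewrite /inv_exp /inv_shift /inv_dev /odd_peak ltnNge leq_ord subnS subnn.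
rewrite PoszD -val_eqE /=; case: ifP => [/eqP->|j_neq0].
  rewrite !PoszM !inv_expE ?leq_ord //.
  have -> : (i == 0%N :> nat)%:Z = (e%:Z + 1) * inv_dev e i 0 + e%:Z * inv_dev e i 1 + 1.
    by rewrite inv_dev_recr0 subrK.
  by rewrite -[e.+1]addn1 PoszD; ring.
rewrite PoszM !inv_expE ?leq_ord //.
case: j j_neq0 => [[|j] lt_jn] //= _; rewrite -(inv_dev_recr e); ring.
Qed.

End InverseOfPhi.

Theorem mainTheorem3 (k : closedFieldType) (d n : nat)
    (hd : (2 <= d)%N) (hn : (2 <= n)%N) :
  let d' := (\sum_(0 <= i < n) (d - 1) ^ i)%N in
  [/\ is_cremona (phi k d n),
      is_monomial (phi k d n),
      has_degree (phi k d n) d,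
      (forall psi : coords k n,
         is_inverse (phi k d n) psi -> has_degree psi d')
    & (2 < d)%N ->
      d'%:R = ((d%:R - 1) ^+ n - 1) / (d%:R - 2) :> rat].
Proof.
case: d hd => [|e] // e_gt0; rewrite ltnS in e_gt0; rewrite subn1 /=.
have n_gt0 : (0 < n)%N := ltnW hn.
have phiE := phi_monomial_map e n k.
have deg_phi := @mdeg_phi_mnm e n.
have deg_inv := @mdeg_inv_mnm e n e_gt0.
have [C CE] := phi_inv_mnm e_gt0 n_gt0; have [D DE] := inv_phi_mnm e_gt0 n_gt0.
pose g := monomial_map k (inv_mnm e (n := n)).
have phi_g i : tnth (comp_map (phi k e.+1 n) g) i = 'X_[C] * 'X_i.
  by rewrite phiE comp_monomial_map tnth_mktuple CE mpolyXD.
have g_phi i : tnth (comp_map g (phi k e.+1 n)) i = 'X_[D] * 'X_i.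
  by rewrite phiE comp_monomial_map tnth_mktuple DE mpolyXD.
have idE i : tnth (id_map k n) i = 'X_i by rewrite tnth_mktuple.
have same_id c f : (forall i, tnth f i = c * 'X_i) -> same_map f (id_map k n).
  by move=> fE; apply: (same_map_scale (c := c)) => i; rewrite idE.
have is_map m b : (forall i, mdeg (m i) = b) -> is_rational_map (monomial_map k m).
  move=> deg_m; split; last exact: not_all_zero_monomial_map.
  by exists b; apply: forms_of_degree_monomial_map.
split.
- split; first by rewrite phiE; apply: is_map deg_phi.
  exists g; split; first exact: is_map deg_inv.
    by split; [rewrite phiE comp_monomial_map; apply: not_all_zero_monomial_map | apply: same_id phi_g].
  by split; [rewrite phiE comp_monomial_map; apply: not_all_zero_monomial_map | apply: same_id g_phi].
- by rewrite phiE; apply: is_monomial_monomial_map deg_phi.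
- rewrite phiE; apply: (has_degree_monomial_map deg_phi) => [j|i j]; last exact: mulrC.
  exact: phi_mnm_eq0.
- move=> psi [[[b psi_homog] _] _ [_ psi_phi]].
  apply: (has_degree_monomial_map deg_inv); first exact: inv_mnm_eq0.
  (* An arbitrary inverse is proportional to [g], whose coordinates are already free of common
     factors. *)
  apply: left_inverse_unique psi_homog _ phi_g psi_phi.
  by rewrite -msize_poly_eq0 msizeX.
move=> e_gt1.
have e_neq1 : e%:R - 1 != 0 :> rat by rewrite subr_eq0 pnatr_eq1 gtn_eqF.
rewrite -natr1 addrK (_ : e%:R + 1 - 2 = e%:R - 1 :> rat); last by ring.
(* With d - 1 = e this is e^n - 1 = (e - 1)(1 + e + ... + e^(n-1)). *)
apply: (canRL (mulfK e_neq1)); rewrite subrX1 mulrC big_mkord natr_sum.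
by congr (_ * _); apply: eq_bigr => i _; rewrite natrX.
Qed.
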